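(* Let $X$ be a compact space. Then the Alexandroff duplicate $AD(X)$ admits an $r$-skeleton if and only if there is an $r$-skeleton $\{r_{(A,B)}:(A,B)\in\Gamma\}$ on $X$ with induced space $Y$ such that $\Gamma\subseteq[Y]^{\le\omega}\times[X\setminus Y]^{\le\omega}$ is $\sigma$-complete and cofinal in $[Y]^{\le\omega}\times[X\setminus Y]^{\le\omega}$, and the following conditions hold: $( * )$ for every $B\in[X\setminus Y]^{\le\omega}$, $\mathrm{cl}_X(B)\setminus B\subseteq Y$; $( ** )$ for every $B\in[X\setminus Y]^{\le\omega}$, $\mathrm{cl}_X(B)\setminus B$ is cosmic; $( *** )$ for every $(A,B)\in\Gamma$, $A\subseteq r_{(A,B)}(X)$ and $\mathrm{cl}_X(B)\setminus B\subseteq r_{(A,B)}(X)$.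
   Context: All spaces are Tychonoff. $[Z]^{\le\omega}$ is the set of all countable subsets of $Z$. A retraction in $X$ is a continuous map $r:X\to X$ with $r\circ r=r$. A space is cosmic if it has a countable network. A partially ordered set $\Gamma$ is up-directed if any two elements have a common upper bound, and $\sigma$-complete if every increasing sequence $\langle s_n\rangle_{n<\omega}$ in $\Gamma$ has a supremum in $\Gamma$. An $r$-skeleton on a space $X$ is a family $\{r_s:s\in\Gamma\}$ of retractions in $X$, indexed by an up-directed $\sigma$-complete partially ordered set $\Gamma$, such that: (i) $r_s(X)$ is cosmic for each $s\in\Gamma$; (ii) $r_s=r_s\circ r_t=r_t\circ r_s$ whenever $s\le t$; (iii) if $\langle s_n\rangle_{n<\omega}\subseteq\Gamma$ is increasing and $s=\sup\{s_n:n<\omega\}$, then $r_s(x)=\lim_{n\to\infty}r_{s_n}(x)$ for each $x\in X$; (iv) $x=\lim_{s\in\Gamma}r_s(x)$ for each $x\in X$. The induced space is $\bigcup_{s\in\Gamma}r_s(X)$. Subsets $\Gamma$ of $[Y]^{\le\omega}\times[X\setminus Y]^{\le\omega}$ are ordered by $(A,B)\preceq(A',B')$ iff $A\subseteq A'$ and $B\subseteq B'$. Such a $\Gamma$ is required to be up-directed and $\sigma$-complete in this order; suprema are taken in $\Gamma$, and the supremum in $\Gamma$ of an increasing sequence $\langle(A_n,B_n)\rangle_{n<\omega}$ is not necessarily $(\bigcup_n A_n,\bigcup_n B_n)$. The Alexandroff duplicate $AD(X)$ of $X$ is the set $X\times\{0,1\}$ with the topology in which all points of $X\times\{1\}$ are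 isolated and basic neighborhoods of $(x,0)$ are the sets $(U\times\{0,1\})\setminus\{(x,1)\}$ with $U$ a neighborhood of $x$ in $X$. *)

(* Defs.v *)
From HB Require Import structures.
From mathcomp Require Import all_boot all_order.
From mathcomp Require Import boolp classical_sets functions cardinality filter.
From mathcomp Require Import topology.

Set Implicit Arguments.
Unset Strict Implicit.
Unset Printing Implicit Defensive.

Local Open Scope classical_set_scope.

(* [Z]^{<= omega} *)
Definition countable_subsets {T : Type} (Z : set T) : set (set T) :=
  [set A | A `<=` Z /\ countable A].

(* [Y]^{<= omega} x [T \ Y]^{<= omega}, in the componentwise inclusion order. *)
Definition countable_pairs {T : Type} (Y : set T) : set (set T *p set T) :=
  countable_subsets Y `*` countable_subsets (~` Y).

Lemma le_pairE {T : Type} (p q : set T *p set T) :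
  (p <= q)%O <-> p.1 `<=` q.1 /\ p.2 `<=` q.2.
Proof.
rewrite Order.ProdOrder.leEprod.
by split=> [/andP[/subsetPset ? /subsetPset ?]|[/subsetPset ? /subsetPset ?]] //;
  apply/andP.
Qed.

Section posets.
Context {d : Order.disp_t} {I : porderType d}.
Implicit Types (G D : set I) (u : nat -> I) (s : I).

(* Directed sets are nonempty, as usual for index sets of nets. *)
Definition up_directed G :=
  G !=set0 /\
  forall s t, G s -> G t -> exists2 v, G v & (s <= v)%O /\ (t <= v)%O.

Definition increasing_in G u :=
  (forall n, G (u n)) /\ {homo u : m n / (m <= n)%N >-> (m <= n)%O}.

(* The supremum is relative to G: least among the upper bounds lying in G;
   it may differ from the supremum in the ambient order I. *)
Definition is_sup_in G u s :=
  let UB := G `&` ubound (range u) in UB s /\ lbound UB s.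

Definition sigma_complete G :=
  forall u, increasing_in G u -> exists s, is_sup_in G u s.

Definition cofinal_in D G :=
  G `<=` D /\ forall s, D s -> exists2 t, G t & (s <= t)%O.

Definition tails G : set_system I :=
  filter_from G (fun s => [set t | G t /\ (s <= t)%O]).

End posets.

Definition network {T : topologicalType} (N : set (set T)) :=
  forall (x : T) (U : set T), open U -> U x -> exists2 P, N P & P x /\ P `<=` U.

Definition cosmic (T : topologicalType) :=
  exists2 N : set (set T), countable N & network N.

Definition retraction {X : topologicalType} (r : X -> X) :=
  continuous r /\ forall x, r (r x) = r x.

(* The index set is a subset G of a poset I; the values of r outside G are
   irrelevant. In (i), the set range (r s), read as a type, carries the
   subspace topology. *)
Record r_skeleton {X : topologicalType} {d : Order.disp_t} {I : porderType d}
    (G : set I) (r : I -> X -> X) : Prop := RSkeleton {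
  rsk_directed : up_directed G;
  rsk_complete : sigma_complete G;
  rsk_retraction : forall s, G s -> retraction (r s);
  rsk_cosmic : forall s, G s -> cosmic (set_type (range (r s)));
  rsk_comp : forall s t, G s -> G t -> (s <= t)%O ->
    r s = r s \o r t /\ r s = r t \o r s;
  rsk_sup : forall u s, increasing_in G u -> is_sup_in G u s ->
    forall x, r (u n) x @[n --> \oo] --> r s x;
  rsk_lim : forall x, r s x @[s --> tails G] --> x
}.

Definition induced_space {X : topologicalType} {I : Type}
    (G : set I) (r : I -> X -> X) : set X :=
  \bigcup_(s in G) range (r s).

Definition admits_r_skeleton (X : topologicalType) :=
  exists (d : Order.disp_t) (I : porderType d) (G : set I) (r : I -> X -> X),
    r_skeleton G r.

(* The level 0 of the duplicate is encoded by false, the level 1 by true.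
   An alias, so as not to inherit the product topology. *)
Definition alexandroff_duplicate (X : topologicalType) : Type := (X * bool)%type.

HB.instance Definition _ (X : topologicalType) :=
  Choice.copy (alexandroff_duplicate X) (X * bool)%type.

Section alexandroff_duplicate_topology.
Context {X : topologicalType}.
Local Notation AD := (alexandroff_duplicate X).
Implicit Types (U : set X) (W : set AD) (x : X).

Definition ad_basic x U : set AD := (U `*` setT) `\ (x, true).

(* The topology determined by these neighborhoods, stated through open sets so
   as to be a topology for every X. For X a T1 space the sets ad_basic x U,
   with U a neighborhood of x, are a neighborhood base at (x, false), see
   nbhs_ad_false. *)
Definition ad_open W :=
  forall x, W (x, false) -> exists2 U, nbhs x U & ad_basic x U `<=` W.

Let ad_openT : ad_open setT.
Proof. by move=> x _; exists setT => //; exact: filterT. Qed.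

Let ad_openI : setI_closed ad_open.
Proof.
move=> V W oV oW x [/oV[U nU UV] /oW[U' nU' UW]].
exists (U `&` U'); first exact: filterI.
by move=> [y b] [[[Uy U'y] _] ne]; split; [apply: UV|apply: UW].
Qed.

Let ad_open_bigU (J : Type) (f : J -> set AD) :
  (forall j, ad_open (f j)) -> ad_open (\bigcup_j f j).
Proof.
move=> of_ x [j _ /of_[U nU Uf]]; exists U => //.
by move=> p /Uf fjp; exists j.
Qed.

HB.instance Definition _ :=
  isOpenTopological.Build AD ad_openT ad_openI ad_open_bigU.

Lemma open_ad_true x : open ([set (x, true)] : set AD).
Proof. by move=> y []. Qed.

Lemma nbhs_ad_false x : accessible_space X ->
  nbhs ((x, false) : AD) = filter_from (nbhs x) (ad_basic x).
Proof.
move=> aX; apply/seteqP; split=> A.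
  rewrite (@nbhsE AD) => -[W [oW Wx] WA]; have [U nU UW] := oW _ Wx.
  by exists U => // p /UW /WA.
move=> [U nU UA]; rewrite (@nbhsE AD); exists (ad_basic x U^°).
  split; last by split=> //; split.
  move=> y [[Uy _] _] /=.
  have [->|yx] := eqVneq y x; first by exists U^° => //; exact: nbhs_interior.
  have [V [oV yV xV]] := aX _ _ yx.
  exists (U^° `&` V).
    apply: filterI; first exact: nbhs_interior.
    by apply: open_nbhs_nbhs; split => //; exact: set_mem.
  move=> [z b] [[[Uz Vz] _] _]; split=> // -[zx _].
  by move: xV; rewrite inE; apply; rewrite -zx.
by move=> [y b] [[/interior_subset Uy _] ne]; apply: UA.
Qed.

End alexandroff_duplicate_topology.

(* Main.v *)
Require Import Defs.
From HB Require Import structures.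
From mathcomp Require Import all_boot all_order finmap.
From mathcomp Require Import boolp classical_sets functions cardinality filter.
From mathcomp Require Import topology.

(** Write AD for the duplicate of X; its points (x, true) are isolated, and the
points (x, false) form a closed copy of X, called the base below.

From right to left.  Let {r_(A,B)} be a skeleton on X as in the statement.
For (A, B) in the index set, every limit point of B lies in the range of
r_(A,B): the hypotheses make B discrete and put the rest of its closure in
that range.  Hence, for a countable set D contained in the union of B and the
range of r_(A,B), there is a retraction of AD that acts on the base as r_(A,B),
fixes (x, true) for x in D, and sends (x, true) to (r_(A,B) x, false) for the
other x; it is continuous because the limit points of D are fixed by r_(A,B).
These retractions form a skeleton once they are indexed by the pairs
((A, B), D).  The set D is a separate coordinate because the supremum of a
sequence of pairs (A_n, B_n) may be strictly larger than the union, whereas the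
isolated points fixed at a supremum must be exactly those fixed at some stage
(duplicate_skeleton).

From left to right.  Let {R_s} be a skeleton on AD.  Three steps turn it into a
skeleton on X indexed by pairs of countable sets.

- Passing to a cofinal subset of the indices closed under suprema, every R_s
  maps only e to an isolated point e of its range (isolated_skeleton).  Then
  R_s maps the base to itself, and restricts to a retraction r_s of X.

- Let Y be the set of x such that (x, false) is fixed by some R_s.  There is a
  monotone map phi from the countable subsets of X to the indices that turns
  increasing unions into suprema, and such that R_(phi C) fixes (x, true), and
  also (x, false) if x is in Y, for all x in C (sigma_reindexing).  Put
  r_(A,B) = r_s with s = phi (A u B), for all pairs of countable sets A in Y
  and B off Y.  Suprema of pairs are then unions, and all the clauses of the
  statement are read off from the points that R_s fixes, its range being closed
  and cosmic.

- The indices phi (A u B) need not be cofinal, so the convergence of r_(A,B)(x)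
  to x has to be proved anew.  By compactness, along any directed family of
  indices R_t(y) converges to y for all y in the closure of the union of the
  ranges (closure_skeleton_lim), and here this closure is all of AD. *)

Set Implicit Arguments.
Unset Strict Implicit.
Unset Printing Implicit Defensive.

Import Order.Theory.

Local Open Scope classical_set_scope.

(** * Countable sets and directed suprema *)

Lemma countableU {T : Type} (A B : set T) :
  countable A -> countable B -> countable (A `|` B).
Proof.
by move=> cA cB; rewrite -bigcup2E; apply: bigcup_countable => // -[|[]].
Qed.

(** Options make this hold for the empty set, on a type that may be empty. *)
Lemma countable_enum {T : Type} (C : set T) : countable C ->
  exists e : nat -> option T, forall x, C x <-> exists n, e n = Some x.
Proof.
move=> /countable_injP[f f_inj].
have /choice[e eP] n : exists o : option T,
    if o is Some x then C x /\ f x = n else forall x, C x -> f x <> n.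
  have [[x [Cx fx]]|nex] := pselect (exists x, C x /\ f x = n).
    by exists (Some x).
  by exists None => x Cx fx; apply: nex; exists x.
exists e => x; split=> [Cx|[n en]]; last by have := eP n; rewrite en => -[].
exists (f x); have := eP (f x); case: (e (f x)) => [y [Cy fy]|/(_ x Cx)//].
by rewrite (f_inj x y) ?inE.
Qed.

Section posets.
Context {d : Order.disp_t} {I : porderType d}.
Implicit Types (G : set I) (u : nat -> I) (s t v : I).

Lemma is_sup_inP G u s : is_sup_in G u s <->
  [/\ G s, forall n, (u n <= s)%O &
      forall v, G v -> (forall n, (u n <= v)%O) -> (s <= v)%O].
Proof.
split=> [[[Gs us] ls]|[Gs us ls]].
  split=> // [n|v Gv uv]; first by apply: us; exists n.
  by apply: ls; split=> // _ [n _ <-].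
split; first by split=> // _ [n _ <-].
by move=> v [Gv uv]; apply: ls => // n; apply: uv; exists n.
Qed.

Lemma is_sup_in_uniq G u s t : is_sup_in G u s -> is_sup_in G u t -> s = t.
Proof. by move=> [us ls] [ut lt]; apply/le_anti; rewrite ls // lt. Qed.

Lemma increasing_inS G u :
  (forall n, G (u n)) -> (forall n, (u n <= u n.+1)%O) -> increasing_in G u.
Proof.
by move=> Gu uS; split=> //; apply: homo_leq => // y x z; apply: le_trans.
Qed.

Lemma cvg_tailsP {T : topologicalType} G (f : I -> T) (l : T) :
  f s @[s --> tails G] --> l <->
  forall U, nbhs l U -> exists2 s, G s & forall t, G t -> (s <= t)%O -> U (f t).
Proof.
split=> [fl U /fl[s Gs sU]|fl U /fl[s Gs sU]]; exists s => //.
  by move=> t Gt st; apply: sU.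
by move=> t [Gt st]; apply: sU.
Qed.

Lemma up_directed_seq {T : eqType} G (f : T -> I) (l : seq T) :
  up_directed G -> (forall x, x \in l -> G (f x)) ->
  exists2 v, G v & forall x, x \in l -> (f x <= v)%O.
Proof.
move=> [[s0 Gs0] dirG]; elim: l => [|x l IH] Gf; first by exists s0.
have [y ly|v Gv lv] := IH; first by apply: Gf; rewrite inE ly orbT.
have [|w Gw [vw xw]] := dirG _ _ Gv (Gf x _); first by rewrite inE eqxx.
exists w => // y; rewrite inE => /predU1P[->//|/lv yv].
exact: le_trans yv vw.
Qed.

Lemma seq_sub_bigcup {T : eqType} (C : nat -> set T) (l : seq T) :
  (forall n m, (n <= m)%N -> C n `<=` C m) ->
  [set` l] `<=` \bigcup_n C n -> exists n, [set` l] `<=` C n.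
Proof.
move=> Cmono; elim: l => [|x l IH] lC; first by exists 0%N.
have [y ly|n ln] := IH; first by apply: lC; rewrite /= inE ly orbT.
have [|m _ Cmx] := lC x; first by rewrite /= inE eqxx.
exists (maxn n m) => y /=; rewrite inE => /predU1P[->|ly].
  exact: Cmono (leq_maxr _ _) _ Cmx.
by apply: Cmono (leq_maxl _ _) _ (ln _ _).
Qed.

(** The value at F is built by recursion on the cardinality of F: it bounds all
the values at proper subsets of F, of which there are finitely many. *)
Lemma finite_reindexing {T : choiceType} G (b : T -> I) :
  up_directed G -> (forall x, G (b x)) ->
  exists phi : {fset T} -> I,
    [/\ forall F, G (phi F), forall F x, x \in F -> (b x <= phi F)%O &
        forall F F', (F `<=` F')%fset -> (phi F <= phi F')%O].
Proof.
move=> dirG Gb; have [[s0 Gs0] dirG2] := dirG.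
have /choice[ub ubP] (p : {fset T} * ({fset T} -> I)) : exists v,
    (forall F, G (p.2 F)) -> [/\ G v,
      forall x, x \in p.1 -> (b x <= v)%O &
      forall F, (F `<=` p.1)%fset -> (p.2 F <= v)%O].
  case: p => F f /=.
  have [Gf|nGf] := pselect (forall F, G (f F)); last by exists s0.
  have [v Gv bv] := @up_directed_seq T G b F dirG (fun x _ => Gb x).
  have [w Gw fw] := @up_directed_seq _ G f (fpowerset F) dirG (fun x _ => Gf x).
  have [z Gz [vz wz]] := dirG2 _ _ Gv Gw.
  exists z => _; split=> // [x /bv|F' FF']; first by move/le_trans; apply.
  by apply: le_trans wz; apply: fw; rewrite fpowersetE.
pose f := fix f n : {fset T} -> I :=
  if n is m.+1 then fun F => ub (F, f m) else fun=> s0.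
have Gf n F : G (f n F).
  by elim: n F => //= n IH F; have [] := ubP (F, f n) IH.
have fS n F F' : (F `<=` F')%fset -> (f n F <= f n.+1 F')%O.
  by have [_ _ /(_ F)] := ubP (F', f n) (Gf n).
have f_lt n k F F' : (F `<=` F')%fset -> (f n F <= f (n + k).+1 F')%O.
  elim: k F' => [|k IH] F' FF'; first by rewrite addn0; exact: fS.
  by apply: (le_trans (IH _ FF')); rewrite addnS; apply: fS.
(* The stage n.+1 at F bounds the stage n at all subsets of F, so that taking F
   at the stage of its cardinality puts its proper subsets at earlier stages. *)
exists (fun F => f #|`F|%fset F); split=> // [F x xF|F F' FF'].
  have : (0 < #|`F|%fset)%N by rewrite cardfs_gt0; apply/fset0Pn; exists x.
  by case: #|`F|%fset => // n _; have [_ + _] := ubP (F, f n) (Gf n); apply.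
have [->//|/fproper_ltn_card ltFF'] := eqVfproper FF'.
by rewrite -(subnKC ltFF') addSn; apply: f_lt.
Qed.

(** The value at a countable C is the supremum of the finite_reindexing values
at the finite subsets of C.  It exists because these finite subsets have a
cofinal increasing sequence, the initial parts of an enumeration of C; that it
is least among all the bounds makes it independent of the enumeration and gives
the commutation with increasing unions. *)
Lemma sigma_reindexing {T : choiceType} G (b : T -> I) :
  up_directed G -> sigma_complete G -> (forall x, G (b x)) ->
  exists phi : set T -> I,
    [/\ forall C, countable C -> G (phi C),
        forall C x, countable C -> C x -> (b x <= phi C)%O,
        forall C C', countable C -> countable C' -> C `<=` C' ->
          (phi C <= phi C')%O &
        forall C : nat -> set T, (forall n, countable (C n)) ->
          (forall n m, (n <= m)%N -> C n `<=` C m) ->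
          is_sup_in G (phi \o C) (phi (\bigcup_n C n))].
Proof.
move=> dirG scG Gb.
have [psi [Gpsi bpsi psi_mono]] := finite_reindexing dirG Gb.
have /choice[phi phiP] (C : set T) : exists s, countable C ->
    [/\ G s, forall F : {fset T}, [set` F] `<=` C -> (psi F <= s)%O &
        forall v, G v ->
          (forall F : {fset T}, [set` F] `<=` C -> (psi F <= v)%O) ->
          (s <= v)%O].
  have [cC|ncC] := pselect (countable C); last first.
    by exists (psi fset0).
  have [e eP] := countable_enum cC.
  pose E n : {fset T} := [fset x in pmap e (iota 0 n)]%fset.
  have in_E n x : (x \in E n) = (Some x \in map e (iota 0 n)).
    by rewrite -mem_pmap in_fset.
  have E_mono n m : (n <= m)%N -> (E n `<=` E m)%fset.
    move=> nm; apply/fsubsetP => x; rewrite !in_E.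
    by rewrite -(subnKC nm) iotaD map_cat mem_cat => ->.
  have EP x : C x -> exists n, x \in E n.
    by move=> /eP[n en]; exists n.+1; rewrite in_E -en map_f// mem_iota ltnSn.
  have EC n : [set` E n] `<=` C.
    by move=> x /=; rewrite in_E => /mapP[k _ ek]; apply/eP; exists k.
  have Einc : increasing_in G (psi \o E).
    by split=> [n|n m nm /=]; [exact: Gpsi|exact/psi_mono/E_mono].
  have [s /is_sup_inP[Gs us ls]] := scG _ Einc.
  exists s => _; split=> // [F FC|v Gv Cv]; last first.
    by apply: ls => // n; apply: Cv.
  have [||n Fn] := @seq_sub_bigcup _ (fun n => [set` E n]) F.
  - by move=> n m nm x /=; apply: fsubsetP (E_mono _ _ nm) x.
  - by move=> x /FC/EP[n xn]; exists n.
  by apply: le_trans (us n); apply/psi_mono/fsubsetP.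
have phi_mono C C' : countable C -> countable C' -> C `<=` C' ->
    (phi C <= phi C')%O.
  move=> cC cC' CC'; have [_ _ lC] := phiP _ cC.
  have [GC' uC' _] := phiP _ cC'.
  by apply: lC => // F FC; apply: uC'; apply: subset_trans CC'.
exists phi; split=> // [C /phiP[]//|C x /phiP[_ uC _] Cx|C cC Cmono].
  apply: (@le_trans _ _ (psi [fset x]%fset)).
    by apply: bpsi; rewrite inE.
  by apply: uC => y /=; rewrite inE => /eqP ->.
have cU : countable (\bigcup_n C n) by apply: bigcup_countable.
have [GU uU lU] := phiP _ cU.
apply/is_sup_inP; split=> // [n|v Gv Cv].
  by apply: phi_mono => //; exact: bigcup_sup.
apply: lU => // F /(seq_sub_bigcup Cmono)[n Fn].
by apply: le_trans (Cv n); have [_ uC _] := phiP _ (cC n); apply: uC.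
Qed.

End posets.

(** * Cosmic subspaces and compactness *)

(** Networks of subspaces are thus families of subsets of the whole space, which
restrict to smaller subspaces and are carried along maps. *)
Lemma cosmic_set_typeP {T : topologicalType} (A : set T) :
  cosmic (set_type A) <->
  exists2 N : set (set T), countable N &
    forall x U, A x -> open U -> U x -> exists2 P, N P & P x /\ P `<=` U.
Proof.
split=> [[N cN netN]|[N cN netN]].
  exists (image N (image^~ set_val)).
    exact: sub_countable (card_image_le _ _) cN.
  move=> x U Ax oU Ux; pose x' : A := SigSub (mem_set Ax).
  have [||P NP [Px PU]] := netN x' (set_val @^-1` U).
  - by exists U.
  - by [].
  by exists (set_val @` P); [exists P|split; [exists x'|move=> _ [y /PU ? <-]]].
exists (image N (preimage set_val)).
  exact: sub_countable (card_image_le _ _) cN.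
move=> x W [U oU <-] Ux.
have [P NP [Px PU]] := netN _ U (set_mem (valP x)) oU Ux.
by exists (set_val @^-1` P); [exists P|split=> // y /PU].
Qed.

Lemma cosmic_subset {T : topologicalType} (A B : set T) :
  A `<=` B -> cosmic (set_type B) -> cosmic (set_type A).
Proof.
move=> AB /cosmic_set_typeP[N cN netN]; apply/cosmic_set_typeP.
by exists N => // x U /AB; exact: netN.
Qed.

(** A network contains the singleton of each isolated point. *)
Lemma countable_isolated {T : topologicalType} (A : set T) :
  cosmic (set_type A) -> countable [set e | A e /\ open [set e]].
Proof.
move=> /cosmic_set_typeP[N cN netN].
apply: sub_countable cN; apply/pcard_leP.
have : set_fun [set e | A e /\ open [set e]] N (@set1 T).
  move=> e [Ae oe]; have [P NP [Pe sPe]] := netN e _ Ae oe erefl.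
  by rewrite (_ : [set e] = P)//; apply/seteqP; split=> // _ ->.
move=> h; apply/injfunPex; exists set1 => //.
by move=> x y _ _ xy; have : [set x] x by []; rewrite xy.
Qed.

Lemma compact_seq_cluster {T : topologicalType} (p : nat -> T) :
  compact [set: T] ->
  exists x, forall C n, closed C -> (forall m, (n <= m)%N -> C (p m)) -> C x.
Proof.
move=> cT; have [|x [_ +]] := cT (p @ \oo); first exact: filterT.
rewrite clusterE => px; exists x => C n cC Cp.
by apply: cC; apply: px; exists n => // m /Cp.
Qed.

(** * Skeletons on compact spaces *)

Section retractions.
Context {X : topologicalType} (hX : hausdorff_space X) (f : X -> X).
Hypothesis f_retr : retraction f.

Lemma range_retraction x : range f x <-> f x = x.
Proof. by split=> [[y _ <-]|<-]; [case: f_retr|exists x]. Qed.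

Lemma closed_range_retraction : closed (range f).
Proof.
move=> x clx; apply/range_retraction/hX => A B nA nB.
have [cf _] := f_retr.
have nfA : nbhs x (f @^-1` A) by exact: cf.
have [y [/range_retraction fy [/= Ay By]]] := clx _ (filterI nfA nB).
by exists y; split=> //; rewrite -fy.
Qed.

End retractions.

Section skeletons.
Context {X : topologicalType} {d : Order.disp_t} {I : porderType d}.
Context {G : set I} {R : I -> X -> X}.
Hypotheses (hX : hausdorff_space X) (cX : compact [set: X]).
Hypothesis RS : r_skeleton G R.

Lemma skeleton_range s x : G s -> range (R s) x <-> R s x = x.
Proof. by move=> Gs; apply/range_retraction/(rsk_retraction RS). Qed.

Lemma skeleton_closed_range s : G s -> closed (range (R s)).
Proof. by move=> Gs; apply/closed_range_retraction/(rsk_retraction RS). Qed.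

Lemma skeleton_continuous s : G s -> continuous (R s).
Proof. by move=> /(rsk_retraction RS)[]. Qed.

Lemma skeleton_compl s t x : G s -> G t -> (s <= t)%O -> R s (R t x) = R s x.
Proof. by move=> Gs Gt /(rsk_comp RS Gs Gt)[e _]; rewrite [in RHS]e. Qed.

Lemma skeleton_compr s t x : G s -> G t -> (s <= t)%O -> R t (R s x) = R s x.
Proof. by move=> Gs Gt /(rsk_comp RS Gs Gt)[_ e]; rewrite [in RHS]e. Qed.

Lemma skeleton_fix s t x :
  G s -> G t -> (s <= t)%O -> R s x = x -> R t x = x.
Proof. by move=> Gs Gt st sx; rewrite -{1}sx skeleton_compr. Qed.

Lemma skeleton_lim x U : nbhs x U ->
  exists2 s, G s & forall t, G t -> (s <= t)%O -> U (R t x).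
Proof. by move: U; apply/cvg_tailsP/(rsk_lim RS). Qed.

Lemma skeleton_sup u s x : increasing_in G u -> is_sup_in G u s ->
  forall U, nbhs (R s x) U ->
  exists n, forall m, (n <= m)%N -> U (R (u m) x).
Proof.
move=> incu us U nU; have [n _ unU] := rsk_sup RS incu us nU.
by exists n => m /unU.
Qed.

(** The iteration scheme of closing-off arguments: a task r n that can be done
above any index is done at the n-th step, and the supremum v lies above all the
steps. *)
Lemma skeleton_chain s (r : nat -> I -> I -> Prop) :
  (forall n t, G t -> exists2 v, G v /\ (t <= v)%O & r n t v) -> G s ->
  exists u v, [/\ increasing_in G u, is_sup_in G u v, (s <= v)%O &
    forall n, r n (u n) (u n.+1)].
Proof.
move=> rP Gs.
have /choice[next nextP] (p : nat * I) : exists v,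
    G p.2 -> [/\ G v, (p.2 <= v)%O & r p.1 p.2 v].
  case: p => n t /=; have [/(rP n)[v [Gv tv] rtv]|nGt] := pselect (G t).
    by exists v.
  by exists t.
pose u := fix u n := if n is m.+1 then next (m, u m) else s.
have Gu n : G (u n) by elim: n => //= n /(nextP (n, _))[].
have incu : increasing_in G u.
  by apply: increasing_inS => // n; have [] := nextP (n, _) (Gu n).
have [v uv] := rsk_complete RS incu.
exists u, v; split=> // [|n]; last by have [] := nextP (n, _) (Gu n).
by have /is_sup_inP[_ /(_ 0%N)] := uv.
Qed.

Lemma skeleton_absorb s (P : set X) : G s -> countable P ->
  P `<=` induced_space G R ->
  exists2 t, G t /\ (s <= t)%O & forall x, P x -> R t x = x.
Proof.
move=> Gs /countable_enum[e eP] PZ.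
have [_ dirG] := rsk_directed RS.
have [n t Gt|u [t [[Gu _] /is_sup_inP[Gt ut _] st eu]]] :=
    @skeleton_chain s (fun n _ v => forall x, e n = Some x -> R v x = x) _ Gs.
  case en : (e n) => [x|]; last by exists t.
  have [|w Gw /(skeleton_range _ Gw) wx] := PZ x; first by apply/eP; exists n.
  have [v Gv [tv wv]] := dirG _ _ Gt Gw.
  by exists v => // _ [<-]; apply: skeleton_fix wx.
exists t => // x /eP[n en].
by apply: (skeleton_fix (Gu n.+1)) => //; apply: eu en.
Qed.

(** A point of U is the limit of its images, which are in the induced space. *)
Lemma skeleton_meets_open U :
  open U -> U !=set0 -> exists2 x, U x & induced_space G R x.
Proof.
move=> oU [x Ux]; have [s Gs sU] := skeleton_lim (open_nbhs_nbhs (conj oU Ux)).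
by exists (R s x); [exact: sU|exists s => //; exists x].
Qed.

(** Closure under the suprema of G makes the suprema relative to H and to G
coincide. *)
Lemma skeleton_cofinal H : H `<=` G ->
  (forall s, G s -> exists2 t, H t & (s <= t)%O) ->
  (forall u s, increasing_in H u -> is_sup_in G u s -> H s) ->
  r_skeleton H R.
Proof.
move=> HG cofH supH.
have incHG u : increasing_in H u -> increasing_in G u.
  by move=> [Hu u_mono]; split=> // n; apply/HG/Hu.
have supHG u s : increasing_in H u -> is_sup_in H u s -> is_sup_in G u s.
  move=> Hu us; have [t ut] := rsk_complete RS (incHG _ Hu).
  rewrite (is_sup_in_uniq us (t := t))//.
  have /is_sup_inP[_ let_ ltt] := ut.
  apply/is_sup_inP; split=> //; first exact: supH ut.
  by move=> v /HG; exact: ltt.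
have [[s0 Gs0] dirG] := rsk_directed RS.
split.
- split; first by have [t Ht _] := cofH _ Gs0; exists t.
  move=> s t /HG Gs /HG Gt; have [v /cofH[w Hw vw] [sv tv]] := dirG _ _ Gs Gt.
  by exists w => //; split; apply: le_trans vw.
- move=> u Hu; have [s us] := rsk_complete RS (incHG _ Hu).
  exists s; have /is_sup_inP[_ let_ ltt] := us.
  apply/is_sup_inP; split=> //; first exact: supH us.
  by move=> v /HG; exact: ltt.
- by move=> s /HG /(rsk_retraction RS).
- by move=> s /HG /(rsk_cosmic RS).
- by move=> s t /HG Gs /HG Gt; exact: (rsk_comp RS).
- by move=> u s Hu us; exact: (rsk_sup RS (incHG _ Hu) (supHG _ _ Hu us)).
- move=> x; apply/cvg_tailsP => U /skeleton_lim[s /cofH[t Ht st] sU].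
  exists t => // v /HG Gv tv.
  by apply: sU => //; apply: le_trans tv.
Qed.

(** Such an e is in the range of R s, so it is fixed and R s q = e says that q
belongs to its fibre. *)
Definition separates_isolated s :=
  forall e q, open [set e] -> R s q = e -> q = e.

(** A nontrivial fibre of R s over an isolated point e contains, besides e, a
point of the dense induced space, since the fibre minus e is open.  The range of
R s being cosmic, there are countably many fibres to treat, so that one index t
fixes a witness in each of them. *)
Lemma separate_isolated_step s : G s ->
  exists2 t, G t /\ (s <= t)%O &
    forall e q, open [set e] -> R s q = e -> q <> e ->
      exists p, [/\ p <> e, R s p = e & R t p = p].
Proof.
move=> Gs.
pose E := [set e | range (R s) e /\ open [set e]].
have cE : countable E by apply: countable_isolated; exact: (rsk_cosmic RS).
have /choice[p pP] e : exists p, forall q, open [set e] -> R s q = e ->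
    q <> e -> [/\ p <> e, R s p = e & induced_space G R p].
  have [[q [oe sq qe]]|nex] :=
      pselect (exists q, [/\ open [set e], R s q = e & q <> e]); last first.
    by exists e => q oe sq qe; exfalso; apply: nex; exists q.
  have [||p [/= sp pe] Zp] := @skeleton_meets_open (R s @^-1` [set e] `\ e).
  - apply: openI; last first.
      exact/closed_openC/accessible_closed_set1/hausdorff_accessible.
    by apply: open_comp => // x _; exact: skeleton_continuous.
  - by exists q.
  by exists p.
pose E' := [set e | E e /\ induced_space G R (p e)].
have [||t Gt tp] := @skeleton_absorb s (p @` E') Gs.
- apply: sub_countable (card_image_le _ _) _.
  by apply: sub_countable cE; apply: subset_card_le => e [].
- by move=> _ [e [_ Zp] <-].
exists t => // e q oe sq qe; have [pe sp Zp] := pP e q oe sq qe.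
exists (p e); split=> //; apply: tp; exists e => //; split=> //; split=> //.
by exists q.
Qed.

(** Given s, iterate separate_isolated_step and let v be the supremum.  If
R v q = e with e isolated and q <> e, then e is reached along the sequence from
some n0 on, and the n-th step provides p n <> e in the fibre of e, fixed at the
next step.  These fibres decrease, so a cluster point x of the p n is different
from e, fixed by R v, and in all the fibres; then x = R v x is the limit of the
constant e, a contradiction. *)
Lemma isolated_skeleton : r_skeleton (G `&` separates_isolated) R.
Proof.
apply: skeleton_cofinal => [s []//|s Gs|u s [Hu u_mono] us]; last first.
  have Gu n : G (u n) by have [] := Hu n.
  have /is_sup_inP[Gs _ _] := us.
  split=> // e q oe sq.
  have := skeleton_sup (x := q) (conj Gu u_mono) us.
  rewrite sq => /(_ [set e])[|n une]; first exact: open_nbhs_nbhs.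
  by have [_ /(_ e q oe)] := Hu n; apply; exact: (une n (leqnn n)).
have [u [v [incu uv sv uS]]] := skeleton_chain
  (fun _ => @separate_isolated_step) Gs.
have [Gu u_mono] := incu.
have /is_sup_inP[Gv le_uv _] := uv.
exists v => //; split=> // e q oe vq; apply: contrapT => qe.
have [n0 une] : exists n0, forall n, (n0 <= n)%N -> R (u n) q = e.
  have := skeleton_sup (x := q) incu uv.
  by rewrite vq => /(_ [set e]); apply; exact: open_nbhs_nbhs.
have ue n : (n0 <= n)%N -> R (u n) e = e.
  by move=> /une ueq; apply/skeleton_range => //; exists q.
have /choice[p pP] n : exists p, (n0 <= n)%N ->
    [/\ p <> e, R (u n) p = e & R (u n.+1) p = p].
  have [n0n|] := boolP (n0 <= n)%N; last by exists e.
  by have [p ?] := uS n e q oe (une _ n0n) qe; exists p.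
have [x xP] := compact_seq_cluster p cX.
have c1 : closed [set e] by exact/accessible_closed_set1/hausdorff_accessible.
have xe : x <> e.
  apply: (xP (~` [set e]) n0); first exact: open_closedC.
  by move=> m /pP[].
have vx : R v x = x.
  apply/(skeleton_range _ Gv); apply: (xP _ n0 (skeleton_closed_range Gv)).
  move=> m /pP[_ _ pm]; apply/skeleton_range => //.
  exact: skeleton_fix pm.
have ux n : (n0 <= n)%N -> R (u n) x = e.
  move=> n0n; apply: (xP (R (u n) @^-1` [set e]) n).
    by apply: closed_comp => // y _; exact: skeleton_continuous.
  move=> m nm /=; have [_ pm _] := pP _ (leq_trans n0n nm).
  by rewrite -(skeleton_compl (p m) (Gu n) (Gu m)) ?u_mono// pm ue.
have [|n nP] := skeleton_sup (x := x) incu uv (U := ~` [set e]).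
  by rewrite vx; apply: open_nbhs_nbhs; split=> //; exact: closed_openC.
by apply: (nP (maxn n n0) (leq_maxl _ _)); apply: ux; exact: leq_maxr.
Qed.

(** Suppose that R t x is off a closed neighbourhood W of x for t arbitrarily
large in T.  Choose by turns such indices t_n, increasing, and points z_n near
x, fixed by R t_(n.+1), that R t_i moves out of W for all i <= n; the latter is
possible by continuity at x.  At the supremum v of the t_n, a cluster point y
of the z_n is fixed by R v and close to x, but R t_n y stays off the interior of
W for all n, so that y = R v y does too, a contradiction. *)
Lemma closure_skeleton_lim T x : T `<=` G ->
  (forall s t, T s -> T t -> exists2 v, T v & (s <= v)%O /\ (t <= v)%O) ->
  closure (induced_space T R) x -> R t x @[t --> tails T] --> x.
Proof.
move=> TG dirT clx; apply/cvg_tailsP => U nU; apply: contrapT => nlim.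
have reg V : nbhs x V -> exists2 W, nbhs x W & closed W /\ W `<=` V.
  move=> nV; have [W nW WV] := compact_regular hX cX filterT nV.
  exists (closure W); first exact: filterS (@subset_closure _ W) nW.
  by split=> //; exact: closed_closure.
have [W nW [cW WU]] := reg U nU.
have [V nV [cV VW]] := reg W° (nbhs_interior nW).
have away t : T t -> exists2 v, T v /\ (t <= v)%O & ~ W (R v x).
  move=> Tt; apply: contrapT => tP; apply: nlim; exists t => // v Tv tv.
  by apply: WU; apply: contrapT => Wv; apply: tP; exists v.
have [t0 Tt0 Wt0] : exists2 t, T t & ~ W (R t x).
  have [z [[t Tt _] _]] := clx _ filterT.
  by have [v [Tv _] Wv] := away t Tt; exists v.
(* A state of the construction: the current index, and a neighbourhood of x that
   all the previous retractions move out of W. *)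
pose good (p : I * set X) := [/\ T p.1, ~ W (R p.1 x) & nbhs x p.2].
have /choice[next nextP] (p : I * set X) : exists q : (I * set X) * X,
    good p -> [/\ good q.1, (p.1 <= q.1.1)%O,
      q.1.2 `<=` p.2 `&` R p.1 @^-1` (~` W), (q.1.2 `&` V) q.2 &
      R q.1.1 q.2 = q.2].
  have [[Tp Wp nM]|ngood] := pselect (good p); last by exists (p, x).
  pose M := p.2 `&` R p.1 @^-1` (~` W).
  have nM' : nbhs x M.
    apply: filterI => //; apply: (skeleton_continuous (TG _ Tp)).
    by apply: open_nbhs_nbhs; split=> //; exact: closed_openC.
  have [z [[w Tw wz] MVz]] := clx _ (filterI nM' nV).
  have [v Tv [pv wv]] := dirT _ _ Tp Tw.
  have [v' [Tv' vv'] Wv'] := away v Tv.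
  exists ((v', M), z) => _; split=> //=; first exact: le_trans vv'.
  have /skeleton_range : range (R w) z by [].
  move=> /(_ (TG _ Tw)); apply: skeleton_fix; [exact: TG|exact: TG|].
  exact: le_trans vv'.
pose u n := iter n (fun p => (next p).1) (t0, setT).
pose z n := (next (u n)).2.
have ugood n : good (u n).
  elim: n => [|n /nextP[]//]; split=> //; exact: filterT.
have incu : increasing_in G (fun n => (u n).1).
  apply: increasing_inS => n; first by have [/TG] := ugood n.
  by have [] := nextP _ (ugood n).
have [Gu u_mono] := incu.
have [v uv] := rsk_complete RS incu.
have /is_sup_inP[Gv le_uv _] := uv.
have M_mono n m : (n <= m)%N -> (u m).2 `<=` (u n).2.
  move=> /subnKC <-; elim: (m - n)%N => [|k IH]; first by rewrite addn0.
  rewrite addnS; apply: subset_trans IH.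
  by have [_ _ sM _ _] := nextP _ (ugood (n + k)%N) => y /sM[].
have [y yP] := compact_seq_cluster z cX.
have Vy : V y.
  by apply: (yP V 0%N) => // m _; have [_ _ _ []] := nextP _ (ugood m).
have vy : R v y = y.
  apply/(skeleton_range _ Gv).
  apply: (yP _ 0%N (skeleton_closed_range Gv)) => m _.
  have [_ _ _ _ zm] := nextP _ (ugood m).
  apply/(skeleton_range _ Gv).
  exact: (skeleton_fix (Gu m.+1) Gv (le_uv m.+1) zm).
have uy n : ~ W° (R (u n).1 y).
  apply: (yP (R (u n).1 @^-1` (~` W°)) n).
    apply: closed_comp => [w _|]; first exact: skeleton_continuous.
    exact/open_closedC/open_interior.
  move=> m nm /= /interior_subset; have [_ _ _ [Mz _] _] := nextP _ (ugood m).
  have [_ _ sM _ _] := nextP _ (ugood n).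
  by have /sM[] := M_mono n.+1 m.+1 nm _ Mz.
have [|n nP] := skeleton_sup (x := y) incu uv (U := W°).
  by rewrite vy; apply: open_nbhs_nbhs; split; [exact: open_interior|exact: VW].
by apply: (uy n); exact: nP.
Qed.

End skeletons.

(** * Topology of the duplicate *)

Section duplicate.
Context {X : topologicalType}.
Hypotheses (hX : hausdorff_space X).
Local Notation AD := (alexandroff_duplicate X).

Let accX : accessible_space X := hausdorff_accessible hX.

Definition ad_base (x : X) : AD := (x, false).
Definition ad_iso (x : X) : AD := (x, true).
Definition ad_proj (p : AD) : X := p.1.

Lemma ad_base_continuous : continuous ad_base.
Proof.
move=> x W; rewrite [nbhs _]nbhs_ad_false// => -[U nU UW].
by apply: filterS nU => y Uy; apply: UW; split=> //; split.
Qed.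

Lemma ad_proj_continuous : continuous ad_proj.
Proof.
apply/continuousP => U oU; suff : ad_open (ad_proj @^-1` U) by [].
by move=> x Ux; exists U; [exact: open_nbhs_nbhs|move=> y [[]]].
Qed.

Lemma nbhs_ad_iso x : nbhs (ad_iso x) [set ad_iso x].
Proof. by apply: open_nbhs_nbhs; split=> //; exact: open_ad_true. Qed.

Lemma ad_hausdorff : hausdorff_space AD.
Proof.
have base x : nbhs (ad_base x) (~` [set ad_iso x]).
  rewrite nbhs_ad_false//; exists setT; first exact: filterT.
  by move=> p [].
move=> [x b] [y c] pq.
have xy : x = y.
  apply: hX => A B nA nB.
  have nA' : nbhs ((x, b) : AD) (ad_proj @^-1` A) by exact: ad_proj_continuous.
  have nB' : nbhs ((y, c) : AD) (ad_proj @^-1` B) by exact: ad_proj_continuous.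
  by have [r [Ar Br]] := pq _ _ nA' nB'; exists r.1.
rewrite xy in pq *; have iy := @nbhs_ad_iso y.
case: b c pq => [] [] // pq.
  by have [r []] := pq _ _ iy (base y).
by have [r []] := pq _ _ (base y) iy.
Qed.

(** An ultrafilter whose projection clusters at x converges to (x, true) if it
contains this singleton, and to (x, false) otherwise. *)
Lemma ad_compact : compact [set: X] -> compact [set: AD].
Proof.
move=> cX; rewrite compact_ultra => F UF _.
have [|x [_ xF]] := cX (ad_proj @ F); first exact: filterT.
have FU U : nbhs x U -> F (ad_proj @^-1` U).
  move=> nU; have [//|FnU] := in_ultra_setVsetC (ad_proj @^-1` U) UF.
  by have [y []] := xF (~` U) U FnU nU.
have [Fi|Fni] := in_ultra_setVsetC [set ad_iso x] UF.
  exists (ad_iso x); split=> // W nW; apply: filterS Fi => _ ->.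
  exact: nbhs_singleton nW.
exists (ad_base x); split=> // W; rewrite nbhs_ad_false// => -[U nU UW].
apply: filterS (filterI (FU U nU) Fni) => -[y b] [Uy ny].
by apply: UW; do 2?split.
Qed.

End duplicate.

(** * From the space to its duplicate *)

Section duplicate_skeleton.
Context {X : topologicalType} {d : Order.disp_t} {I : porderType d}.
(* The points of B s are those that can be fixed on the upper level without
   being in the range of R s. *)
Variables (G : set I) (R : I -> X -> X) (B : I -> set X).
Hypotheses (hX : hausdorff_space X) (RS : r_skeleton G R).
Hypotheses (B_mono : forall s t, G s -> G t -> (s <= t)%O -> B s `<=` B t)
  (limB : forall s, G s -> limit_point (B s) `<=` range (R s))
  (coverB : forall x, exists2 s, G s & (range (R s) `|` B s) x).
Local Notation AD := (alexandroff_duplicate X).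

Definition ad_index : set (I *p set X) :=
  [set p | [/\ G p.1, countable p.2 & p.2 `<=` range (R p.1) `|` B p.1]].

Definition ad_retraction (p : I *p set X) (z : AD) : AD :=
  if z.2 && (z.1 \in p.2) then z else ad_base (R p.1 z.1).

Lemma le_ad_index (p q : I *p set X) :
  (p <= q)%O <-> (p.1 <= q.1)%O /\ p.2 `<=` q.2.
Proof.
rewrite Order.ProdOrder.leEprod.
by split=> [/andP[? /subsetPset ?]|[? /subsetPset ?]] //; apply/andP.
Qed.

Lemma ad_retraction_in p x : p.2 x -> ad_retraction p (ad_iso x) = ad_iso x.
Proof. by move=> px; rewrite /ad_retraction/= mem_set. Qed.

Lemma ad_retraction_notin p x :
  ~ p.2 x -> ad_retraction p (ad_iso x) = ad_base (R p.1 x).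
Proof. by move=> px; rewrite /ad_retraction/= memNset. Qed.

Lemma ad_retraction_base p x :
  ad_retraction p (ad_base x) = ad_base (R p.1 x).
Proof. by []. Qed.

(** At (x, false) with R x = x, points of the upper level near x stay put or go
to R y, near R x = x in both cases.  If R x <> x, then x is off the closed range
of R and is not a limit point of B, so that near x no other point is fixed on
the upper level. *)
Lemma ad_retraction_continuous p : ad_index p -> continuous (ad_retraction p).
Proof.
move=> [Gp _ pS] [x []] W.
  move=> /nbhs_singleton Wx; apply: filterS (@nbhs_ad_iso _ x) => _ -> //.
rewrite [nbhs _]nbhs_ad_false; last exact: hausdorff_accessible.
move=> [U nU UW]; rewrite nbhs_ad_false; last exact: hausdorff_accessible.
have nRU : nbhs x (R p.1 @^-1` U) by exact: (skeleton_continuous RS Gp).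
have base y : U (R p.1 y) -> W (ad_base (R p.1 y)).
  by move=> Uy; apply: UW; split=> // -[].
have [xR|xR] := pselect (range (R p.1) x).
  have Rx : R p.1 x = x by apply/(skeleton_range RS).
  exists (R p.1 @^-1` U `&` U); first by apply: filterI => //; rewrite -{1}Rx.
  move=> [y [|]] [[[/= RUy Uy] _] yx]; last exact: base.
  have [py|py] := pselect (p.2 y); last first.
    by rewrite /= ad_retraction_notin//; exact: base.
  rewrite /= ad_retraction_in//.
  by apply: UW; split=> //; rewrite Rx.
have [V nV BV] : exists2 V, nbhs x V & B p.1 `&` V `<=` [set x].
  by rewrite -not_limit_pointE => /(limB Gp).
exists (R p.1 @^-1` U `&` (~` range (R p.1) `&` V)).
  apply: filterI => //; apply: filterI => //; apply: open_nbhs_nbhs; split=> //.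
  exact/closed_openC/(skeleton_closed_range hX RS).
move=> [y [|]] [[[/= RUy [nRy Vy]] _] yx]; last exact: base.
have [py|py] := pselect (p.2 y); last first.
  by rewrite /= ad_retraction_notin//; exact: base.
have [//|By] := pS _ py.
by exfalso; apply: yx; rewrite (BV y).
Qed.

Lemma ad_retraction_id p z :
  ad_index p -> ad_retraction p (ad_retraction p z) = ad_retraction p z.
Proof.
move=> [Gp _ _]; rewrite {2 3}/ad_retraction.
case: ifPn => [h|_]; first by rewrite /ad_retraction h.
rewrite ad_retraction_base; congr ad_base.
by apply/(skeleton_range RS) => //; exists z.1.
Qed.

Lemma ad_retraction_comp p q z : ad_index p -> ad_index q -> (p <= q)%O ->
  ad_retraction p z = ad_retraction p (ad_retraction q z) /\
  ad_retraction p z = ad_retraction q (ad_retraction p z).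
Proof.
move=> [Gp _ _] [Gq _ _] /le_ad_index[pq1 pq2].
have base x : ad_base (R p.1 x) = ad_base (R p.1 (R q.1 x)) /\
    ad_base (R p.1 x) = ad_base (R q.1 (R p.1 x)).
  by rewrite (skeleton_compl RS)// (skeleton_compr RS).
case: z => x [|]; last exact: base.
rewrite -/(ad_iso x).
have [px|px] := pselect (p.2 x).
  have qx := pq2 _ px.
  by rewrite (ad_retraction_in qx) (ad_retraction_in px) (ad_retraction_in qx).
have [qx|qx] := pselect (q.2 x).
  rewrite (ad_retraction_in qx) (ad_retraction_notin px).
  by split=> //; exact: (base x).2.
by rewrite (ad_retraction_notin px) (ad_retraction_notin qx); exact: base.
Qed.

(** The range is a cosmic part of the base with countably many points added. *)
Lemma ad_retraction_cosmic p :
  ad_index p -> cosmic (set_type (range (ad_retraction p))).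
Proof.
move=> [Gp cp _]; apply/cosmic_set_typeP.
have /cosmic_set_typeP[N cN netN] := rsk_cosmic RS Gp.
exists (image N (image^~ ad_base) `|` [set [set ad_iso x] | x in p.2]).
  by apply: countableU; exact: sub_countable (card_image_le _ _) _.
have base x U : open U -> U (ad_base (R p.1 x)) ->
    exists2 P, N P & (ad_base @` P) (ad_base (R p.1 x)) /\ ad_base @` P `<=` U.
  move=> oU Ux; have [|||P NP [Px PU]] := netN (R p.1 x) (ad_base @^-1` U).
  - by exists x.
  - by apply: open_comp => // y _; exact: ad_base_continuous.
  - by [].
  by exists P => //; split; [exists (R p.1 x)|move=> _ [y /PU ? <-]].
move=> _ U [z _ <-] oU; rewrite /ad_retraction.
case: ifPn => [/andP[zt /set_mem zp] Uz|_ /(base _ _ oU)[P NP PU]].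
  exists [set ad_iso z.1]; first by right; exists z.1.
  by case: z zt {zp} Uz => x [] //= _ Ux; split=> // _ ->.
by exists (ad_base @` P) => //; left; exists P.
Qed.

(** Along an increasing sequence of indices, (x, true) either is fixed from some
stage on, or is treated as (x, false) at all stages; the former happens exactly
when x is in the union of the second coordinates, which is the second coordinate
of the supremum. *)
Lemma duplicate_skeleton : r_skeleton ad_index ad_retraction.
Proof.
have [[s0 Gs0] dirG] := rsk_directed RS.
have grow s t x : G s -> G t -> (s <= t)%O ->
    (range (R s) `|` B s) x -> (range (R t) `|` B t) x.
  move=> Gs Gt st [/(skeleton_range RS _ Gs) sx|]; last first.
    by move=> /(B_mono Gs Gt st); right.
  by left; apply/(skeleton_range RS) => //; exact: (skeleton_fix RS Gs).
have sup u : increasing_in ad_index u -> exists s,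
    is_sup_in G (fun n => (u n).1) s /\
    is_sup_in ad_index u ((s, \bigcup_n (u n).2) : I *p set X).
  move=> [Gu u_mono].
  have Gu1 n : G (u n).1 by have [] := Gu n.
  have [s us] : exists s, is_sup_in G (fun n => (u n).1) s.
    apply: (rsk_complete RS); split=> // m n /u_mono.
    by move=> /le_ad_index[].
  exists s; split=> //; have /is_sup_inP[Gs us1 us2] := us.
  apply/is_sup_inP; split=> [|n|[v C] [Gv cC _] uv].
  - split=> //=; first by apply: bigcup_countable => // n _; have [] := Gu n.
    by move=> x [n _ nx]; have [_ _ /(_ x nx)] := Gu n; exact: grow.
  - by apply/le_ad_index; split=> //= x ux; exists n.
  - apply/le_ad_index; split=> [|x [n _ nx]] /=.
      by apply: us2 => // n; have /le_ad_index[] := uv n.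
    by have /le_ad_index[_] := uv n; apply.
split.
- split; first by exists (s0, set0); split=> //=.
  move=> p q [Gp cp pS] [Gq cq qS]; have [v Gv [pv qv]] := dirG _ _ Gp Gq.
  exists (v, p.2 `|` q.2); last by split; apply/le_ad_index; split=> //=.
  split=> //=.
    exact: countableU.
  by move=> x [/pS|/qS]; exact: grow.
- by move=> u /sup[s [_ us]]; eexists; exact: us.
- move=> p Ip; split=> [|z]; first exact: ad_retraction_continuous.
  exact: ad_retraction_id.
- exact: ad_retraction_cosmic.
- move=> p q Ip Iq pq; split; apply/funext => z;
    by have [] := ad_retraction_comp z Ip Iq pq.
- move=> u p incu up; have [s [us up']] := sup u incu.
  rewrite (is_sup_in_uniq up up') => {p up up'} -[x b].
  have incu1 : increasing_in G (fun n => (u n).1).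
    have [Gu u_mono] := incu.
    by split=> [n|m n /u_mono/le_ad_index[]//]; have [] := Gu n.
  have lim W : nbhs (ad_base (R s x)) W ->
      exists n, forall m, (n <= m)%N -> W (ad_base (R (u m).1 x)).
    move=> nW; apply: (skeleton_sup RS incu1 us (U := ad_base @^-1` W)).
    exact: ad_base_continuous.
  case: b; last by move=> W /lim[n nW]; exists n.
  have [[n _ nx]|nx] := pselect ((\bigcup_n (u n).2) x).
    rewrite ad_retraction_in; last by exists n.
    move=> W nW; exists n => // m /= nm.
    rewrite ad_retraction_in; first exact: nbhs_singleton nW.
    by have [_ /(_ _ _ nm)/le_ad_index[_]] := incu; apply.
  rewrite ad_retraction_notin// => W /lim[n nW]; exists n => // m /= nm.
  by rewrite ad_retraction_notin; [exact: nW|move=> mx; apply: nx; exists m].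
- move=> [x b]; apply/cvg_tailsP => W; case: b => [/nbhs_singleton Wx|].
    have [s Gs sx] := coverB x.
    exists (s, [set x]); first by split=> //= _ ->.
    move=> [t C] _ /le_ad_index[_ /= Cx].
    by rewrite ad_retraction_in//; exact: Cx.
  rewrite nbhs_ad_false; last exact: hausdorff_accessible.
  move=> [U /(skeleton_lim RS)[s Gs sU] UW].
  exists (s, set0); first by split=> //=.
  move=> t [Gt _ _] /le_ad_index[/= st _]; apply: UW; split=> [|[]//].
  by split=> //; exact: sU.
Qed.

End duplicate_skeleton.

(** * From the duplicate to the space *)

Section from_duplicate.
Context {X : topologicalType} (hX : hausdorff_space X).
Local Notation AD := (alexandroff_duplicate X).
Context {d : Order.disp_t} {I : porderType d}.
Variables (G : set I) (R : I -> AD -> AD).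
Hypothesis RS : r_skeleton G R.
Hypothesis sepR : forall s, G s -> separates_isolated (R := R) s.

Definition base_map s (x : X) : X := ad_proj (R s (ad_base x)).

(** A value (y, true) would be isolated, with a base point in its fibre. *)
Lemma base_mapE s x : G s -> R s (ad_base x) = ad_base (base_map s x).
Proof.
move=> Gs; rewrite /base_map; case E: (R s (ad_base x)) => [y [|]]//.
by have := sepR Gs (@open_ad_true _ y) E.
Qed.

Lemma base_map_range s x :
  G s -> range (base_map s) x <-> R s (ad_base x) = ad_base x.
Proof.
move=> Gs; split=> [[y _ <-]|sx]; last by exists x => //; rewrite /base_map sx.
by rewrite -base_mapE//; apply/(skeleton_range RS) => //; exists (ad_base y).
Qed.

Lemma base_map_continuous s : G s -> continuous (base_map s).
Proof.
move=> Gs x; apply: (@continuous_comp _ _ _ (R s \o ad_base)); last first.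
  exact: ad_proj_continuous.
apply: continuous_comp; first exact: ad_base_continuous.
exact: (skeleton_continuous RS).
Qed.

Lemma base_map_cosmic s : G s -> cosmic (set_type (range (base_map s))).
Proof.
move=> Gs; have /cosmic_set_typeP[N cN netN] := rsk_cosmic RS Gs.
apply/cosmic_set_typeP; exists (image N (preimage ad_base)).
  exact: sub_countable (card_image_le _ _) cN.
move=> x U /(base_map_range _ Gs) sx oU Ux.
have [|||P NP [Px PU]] := netN (ad_base x) (ad_proj @^-1` U).
- by exists (ad_base x).
- by apply: open_comp => // y _; exact: ad_proj_continuous.
- by [].
by exists (ad_base @^-1` P); [exists P|split=> // y /PU].
Qed.

Lemma ad_iso_induced x : induced_space G R (ad_iso x).
Proof.
have [||z -> //] := @skeleton_meets_open _ _ _ _ _ RS [set ad_iso x].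
- exact: open_ad_true.
- by exists (ad_iso x).
Qed.

(** If x is in the closure of C but not in C, then (x, false) is in the closure
of the set of points (y, true) with y in C, and these are all in the closed
range of R s. *)
Lemma base_map_closure_diff s (C : set X) : G s ->
  (forall x, C x -> R s (ad_iso x) = ad_iso x) ->
  closure C `\` C `<=` range (base_map s).
Proof.
move=> Gs sC x [clx Cx]; apply/(base_map_range _ Gs)/(skeleton_range RS _ Gs).
apply: (skeleton_closed_range (ad_hausdorff hX) RS Gs) => W.
rewrite nbhs_ad_false; last exact: hausdorff_accessible.
move=> [U /clx[y [Cy Uy]] UW]; exists (ad_iso y); split.
  by apply/(skeleton_range RS) => //; exact: sC.
by apply: UW; split=> // -[yx]; apply: Cx; rewrite -yx.
Qed.

Definition base_trace : set X := ad_base @^-1` induced_space G R.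

(** If x is not isolated, (x, false) is a limit of points (y, true); if x is
isolated, then so is (x, false), and it belongs to the dense induced space. *)
Lemma ad_base_limit T (x : X) : (forall y, induced_space T R (ad_iso y)) ->
  (forall y, base_trace y -> induced_space T R (ad_base y)) ->
  closure (induced_space T R) (ad_base x).
Proof.
move=> Tiso Tbase W.
rewrite nbhs_ad_false; last exact: hausdorff_accessible.
move=> [U nU UW].
have [[y [Uy yx]]|Ux] := pselect (exists y, U y /\ y <> x).
  exists (ad_iso y); split; first exact: Tiso.
  by apply: UW; split=> // -[].
exists (ad_base x); split; last first.
  by apply: UW; split=> //; split=> //; exact: nbhs_singleton nU.
apply: Tbase.
have [||z -> //] := @skeleton_meets_open _ _ _ _ _ RS [set ad_base x].
- suff : ad_open [set ad_base x] by [].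
  move=> y [->]; exists U => // -[z b] [[Uz _] zx].
  have {}Uz : z = x by apply: contrapT => nzx; apply: Ux; exists z.
  by case: b zx; rewrite Uz // => -[].
- by exists (ad_base x).
Qed.

End from_duplicate.

Section countable_pairs.
Context {T : Type} (Y : set T).
Implicit Types p q : set T *p set T.

Lemma countable_pairsP p : countable_pairs Y p <->
  [/\ p.1 `<=` Y, p.2 `<=` ~` Y, countable p.1 & countable p.2].
Proof. by split=> [[[? ?] [? ?]]|[? ? ? ?]]; do ?split. Qed.

Lemma countable_pairs_directed : up_directed (countable_pairs Y).
Proof.
split; first by exists (set0, set0); apply/countable_pairsP; split.
move=> p q /countable_pairsP[pY pY' cp1 cp2] /countable_pairsP[qY qY' cq1 cq2].
exists (p.1 `|` q.1, p.2 `|` q.2).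
  apply/countable_pairsP; split=> /=; [| |exact: countableU|exact: countableU].
    by move=> x [/pY|/qY].
  by move=> x [/pY'|/qY'].
by split; apply/le_pairE; split=> /=.
Qed.

Lemma countable_pairs_sup (u : nat -> set T *p set T) :
  increasing_in (countable_pairs Y) u ->
  is_sup_in (countable_pairs Y) u (\bigcup_n (u n).1, \bigcup_n (u n).2).
Proof.
move=> [Yu _]; have {}Yu n := (countable_pairsP (u n)).1 (Yu n).
apply/is_sup_inP; split=> [|n|v Yv uv].
- apply/countable_pairsP; split=> /=.
  + by move=> x [n _]; have [+ _ _ _] := Yu n; apply.
  + by move=> x [n _]; have [_ + _ _] := Yu n; apply.
  + by apply: bigcup_countable => // n _; have [] := Yu n.
  + by apply: bigcup_countable => // n _; have [] := Yu n.
- by apply/le_pairE; split=> x ux; exists n.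
- by apply/le_pairE; split=> x [n _]; have /le_pairE[+ +] := uv n;
    move=> h1 h2; [apply: h1|apply: h2].
Qed.

End countable_pairs.

Section base_skeleton.
Context {X : topologicalType} (hX : hausdorff_space X)
  (cX : compact [set: X]).
Local Notation AD := (alexandroff_duplicate X).
Context {d : Order.disp_t} {I : porderType d}.
Variables (G : set I) (R : I -> AD -> AD).
Hypothesis RS : r_skeleton G R.
Hypothesis sepR : forall s, G s -> separates_isolated (R := R) s.
Local Notation Y := (base_trace G R).
Variable phi : set X -> I.
Hypotheses (Gphi : forall C, countable C -> G (phi C))
  (phi_mono : forall C C', countable C -> countable C' -> C `<=` C' ->
    (phi C <= phi C')%O)
  (phi_sup : forall C : nat -> set X, (forall n, countable (C n)) ->
    (forall n m, (n <= m)%N -> C n `<=` C m) ->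
    is_sup_in G (phi \o C) (phi (\bigcup_n C n)))
  (phi_iso : forall C x, countable C -> C x ->
    R (phi C) (ad_iso x) = ad_iso x)
  (phi_base : forall C x, countable C -> C x -> Y x ->
    R (phi C) (ad_base x) = ad_base x).

Definition pair_index (p : set X *p set X) : I := phi (p.1 `|` p.2).

Local Notation GP := (countable_pairs Y).
Local Notation r := (fun p => base_map R (pair_index p)).

Let cU p : GP p -> countable (p.1 `|` p.2).
Proof. by move=> /countable_pairsP[_ _ ? ?]; exact: countableU. Qed.

Let Gq p : GP p -> G (pair_index p).
Proof. by move=> /cU/Gphi. Qed.

Let q_mono p p' : GP p -> GP p' -> (p <= p')%O ->
  (pair_index p <= pair_index p')%O.
Proof.
move=> /cU cp /cU cp' /le_pairE[pp1 pp2].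
by apply: phi_mono => //; exact: setUSS.
Qed.

(** The algebraic clauses and the one on suprema come from R through phi; the
convergence to x is closure_skeleton_lim for the family of all the indices
phi (A u B), which need not be cofinal in G. *)
Lemma base_skeleton : r_skeleton GP r.
Proof.
split.
- exact: countable_pairs_directed.
- by move=> u /countable_pairs_sup us; eexists; exact: us.
- move=> p /Gq Gp; split=> [|x]; first exact: (base_map_continuous hX RS).
  have /(base_map_range RS sepR _ Gp) : range (base_map R (pair_index p))
    (base_map R (pair_index p) x) by exists x.
  exact: congr1.
- by move=> p /Gq Gp; exact: (base_map_cosmic RS sepR).
- move=> p p' Gp Gp' pp'; have le_pp' := q_mono Gp Gp' pp'.
  have [{}Gp {}Gp'] := (Gq Gp, Gq Gp').
  split; apply/funext => x /=; rewrite /base_map -(base_mapE sepR)//.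
    by rewrite (skeleton_compl RS).
  by rewrite (skeleton_compr RS).
- move=> u s incu us x.
  rewrite (is_sup_in_uniq us (countable_pairs_sup incu)) => {s us} U nU.
  have [Gu u_mono] := incu.
  pose C n := (u n).1 `|` (u n).2.
  have C_mono n m : (n <= m)%N -> C n `<=` C m.
    by move=> /u_mono/le_pairE[? ?]; exact: setUSS.
  have cC n : countable (C n) by exact: cU.
  have incC : increasing_in G (phi \o C).
    split=> [n|n m nm /=]; first exact: Gphi.
    by apply: phi_mono => //; exact: C_mono.
  have supC := phi_sup cC C_mono; rewrite bigcupU in supC.
  have [|n nP] := skeleton_sup RS incC supC (x := ad_base x)
    (U := ad_proj @^-1` U); first exact: ad_proj_continuous.
  by exists n => // m /= nm; exact: nP.
- move=> x; apply/cvg_tailsP => U nU.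
  pose T := [set pair_index p | p in GP].
  have ind p z : GP p -> R (pair_index p) z = z -> induced_space T R z.
    by move=> Gp pz; exists (pair_index p); [exists p|exists z].
  have TG : T `<=` G by move=> _ [p Gp <-]; exact: Gq.
  have dirT s t : T s -> T t -> exists2 v, T v & (s <= v)%O /\ (t <= v)%O.
    move=> [p Gp <-] [p' Gp' <-].
    have [_ /(_ p p' Gp Gp')[v Gv [pv p'v]]] := countable_pairs_directed Y.
    by exists (pair_index v); [exists v|split; exact: q_mono].
  have single y : exists2 p, GP p & (p.1 `|` p.2) y.
    have [Yy|Yy] := pselect (Y y).
      exists ([set y], set0); last by left.
      by apply/countable_pairsP; split=> //= _ ->.
    exists (set0, [set y]); last by right.
    by apply/countable_pairsP; split=> //= _ ->.
  have clx : closure (induced_space T R) (ad_base x).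
    apply: (ad_base_limit hX RS) => y.
      have [p Gp py] := single y.
      by apply: (ind p) => //; apply: phi_iso => //; exact: cU.
    have [p Gp py] := single y => Yy.
    by apply: (ind p) => //; apply: phi_base => //; exact: cU.
  have /cvg_tailsP/(_ (ad_proj @^-1` U))[|_ [p Gp <-] pU] :=
    closure_skeleton_lim (ad_hausdorff hX) (ad_compact hX cX) RS TG dirT clx.
    exact: ad_proj_continuous.
  by exists p => // p' Gp' pp'; apply: pU; [exists p'|exact: q_mono].
Qed.

Lemma base_skeleton_induced : induced_space GP r = Y.
Proof.
apply/seteqP; split=> [x [p /Gq Gp /(base_map_range RS sepR _ Gp) px]|x Yx].
  by exists (pair_index p) => //; exists (ad_base x).
have Gp : GP ([set x], set0) by apply/countable_pairsP; split=> //= _ ->.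
exists ([set x], set0) => //; apply/(base_map_range RS sepR); first exact: Gq.
by apply: phi_base => //; [exact: cU|left].
Qed.

Lemma base_skeleton_range A B : GP (A, B) ->
  A `<=` range (r (A, B)) /\ closure B `\` B `<=` range (r (A, B)).
Proof.
move=> Gp; have Gq' := Gq Gp; split.
  move=> x Ax; apply/(base_map_range RS sepR) => //.
  apply: phi_base; [exact: cU|by left|].
  by have /countable_pairsP[+ _ _ _] := Gp; exact.
apply: (base_map_closure_diff hX RS sepR) => // x Bx.
by apply: phi_iso; [exact: cU|right].
Qed.

End base_skeleton.

Theorem theorem4p4 (X : topologicalType)
    (hausX : hausdorff_space X) (compX : compact [set: X]) :
  admits_r_skeleton (alexandroff_duplicate X) <->
  exists (Y : set X) (G : set (set X *p set X))
      (r : set X *p set X -> X -> X),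
    [/\ r_skeleton G r /\ induced_space G r = Y,
        sigma_complete G /\ cofinal_in (countable_pairs Y) G,
        (forall B, countable_subsets (~` Y) B -> closure B `\` B `<=` Y),
        (forall B, countable_subsets (~` Y) B ->
          cosmic (set_type (closure B `\` B))) &
        (forall A B, G (A, B) ->
          A `<=` range (r (A, B)) /\
          closure B `\` B `<=` range (r (A, B)))].
Proof.
split.
  move=> [d [I [G0 [R RS0]]]].
  have RS :=
    isolated_skeleton (ad_hausdorff hausX) (ad_compact hausX compX) RS0.
  move: RS; set G := _ `&` _ => RS.
  have sepR s : G s -> separates_isolated (R := R) s by case.
  pose Y := base_trace G R.
  have [[s0 Gs0] _] := rsk_directed RS.
  have /choice[b bP] x : exists s, [/\ G s, R s (ad_iso x) = ad_iso x &
      Y x -> R s (ad_base x) = ad_base x].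
    have [||t [Gt _] tP] := @skeleton_absorb _ _ _ _ _ RS s0
        ([set ad_iso x; ad_base x] `&` induced_space G R) Gs0.
    - apply: sub_countable (subset_card_le (@subIsetl _ _ _)) _.
      by apply: countableU; exact: countable1.
    - by move=> z [].
    exists t; split=> // [|Yx]; apply: tP; split=> //; last by right.
      by left.
    exact: ad_iso_induced RS x.
  have [phi [Gphi bphi phi_mono phi_sup]] := sigma_reindexing
    (rsk_directed RS) (rsk_complete RS) (fun x => let: And3 h _ _ := bP x in h).
  have phi_iso C x : countable C -> C x -> R (phi C) (ad_iso x) = ad_iso x.
    move=> cC Cx; have [Gb bx _] := bP x.
    by apply: (skeleton_fix RS Gb) bx; [exact: Gphi|exact: bphi].
  have phi_base C x : countable C -> C x -> Y x ->
      R (phi C) (ad_base x) = ad_base x.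
    move=> cC Cx /[dup] Yx; have [Gb _ /[apply] bx] := bP x.
    by apply: (skeleton_fix RS Gb) bx; [exact: Gphi|exact: bphi].
  have rangeP := base_skeleton_range hausX RS sepR Gphi phi_iso phi_base.
  have indP := base_skeleton_induced RS sepR Gphi phi_base.
  have skP := base_skeleton hausX compX RS sepR Gphi phi_mono phi_sup
    phi_iso phi_base.
  have GB B : countable_subsets (~` Y) B -> countable_pairs Y (set0, B).
    by move=> [BY cB]; apply/countable_pairsP; split.
  exists Y, (countable_pairs Y), (fun p => base_map R (pair_index phi p)).
  split=> //.
  - split; first exact: rsk_complete skP.
    by split=> // p Gp; exists p.
  - move=> B /GB Gp; have [_ /subset_trans] := rangeP _ _ Gp; apply.
    by rewrite -[X in _ `<=` X]indP => x Bx; exists (set0, B).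
  - move=> B /GB Gp; have [_ /cosmic_subset] := rangeP _ _ Gp; apply.
    exact: (rsk_cosmic skP Gp).
move=> [Y [G [r [[RS indY] [_ [GY cofG]] BY _ rP]]]].
exists _, _, (ad_index G r snd), (ad_retraction r).
apply: duplicate_skeleton => //.
- by move=> s t _ _ /le_pairE[].
- move=> [A B] Gs x /= limx; have [_ rB] := rP _ _ Gs.
  have /countable_pairsP[_ /= BY' _ cB] := GY _ Gs.
  have clx : closure (B `\ x) x.
    by move=> U /limx[y [/eqP yx By Uy]]; exists y.
  have [Bx|Bx] := pselect (B x); last first.
    by apply: rB; split=> //; exact: subset_limit_point.
  (* A point of B that is a limit point of B is in the closure of B minus that
     point, hence in Y by the first condition on closures, applied to this set. *)
  exfalso; apply: (BY' _ Bx); apply: (BY (B `\ x)); last first.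
    by split=> // -[_]; apply.
  split; first by move=> y [/BY'].
  exact: sub_countable (subset_card_le (@subDsetl _ _ _)) cB.
- move=> x; have [Yx|Yx] := pselect (Y x).
    by move: Yx; rewrite -indY => -[s Gs sx]; exists s => //; left.
  have [|[A B] Gs /le_pairE[_ /= xB]] := cofG (set0, [set x]).
    by apply/countable_pairsP; split=> //= _ ->.
  by exists (A, B) => //; right; apply: xB.
Qed.
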